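(* If $\vdash_{\mathsf{LTL}}A$, then the 2-sequent $\vdash A^{\langle 0,\varnothing\rangle}$ is provable in $2_{\mathsf{LTL}}$.
   Context: Temporal formulas are built from proposition symbols using $\neg,\wedge,\vee,\to$, the unary operators $\Box$ (always), $\Diamond$ (sometime) and $\bigcirc$ (next). The Hilbert system $\mathsf{LTL}$ has axioms: A0 all temporal instances of classical propositional tautologies; A1 $\bigcirc(A\to B)\to(\bigcirc A\to\bigcirc B)$; A2 $\neg\bigcirc A\to\bigcirc\neg A$; A3 $\Box(A\to B)\to(\Box A\to\Box B)$; A4 $\Box A\to A$; A5 $\Box A\to\Box\Box A$; A6 $\Box A\to\bigcirc A$; A7 $\Box A\to\bigcirc\Box A$; A8 $A\wedge\Box(A\to\bigcirc A)\to\Box A$; rules: modus ponens, from $A$ infer $\bigcirc A$, from $A$ infer $\Box A$. $\vdash_{\mathsf{LTL}}A$ means $A$ is derivable. Positions for $\mathsf{LTL}$ are pairs $\langle n,S\rangle$ with $n\in\mathbb N$ and $S$ a finite set of tokens from a countably infinite set. For $s=\langle n,S\rangle$, $t=\langle m,T\rangle$: $s\oplus t=\langle n+m,S\cup T\rangle$; $s\oplus m$ means $s\oplus\langle m,\varnothing\rangle$; $s\oplus x$ means $s\oplus\langle 0,\{x\}\rangle$ for a token $x$. A p-formula is $A^s$; a 2-sequent is $\Gamma\vdash\Delta$ with $\Gamma,\Delta$ finite sequences of p-formulas; $x\notin s,\Gamma,\Delta$ means the token $x$ belongs to no position in $s,\Gamma,\Delta$. The calculus $2_{\mathsf{LTL}}$: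 Axiom $A^s\vdash A^s$; unrestricted Cut (from $\Gamma_1\vdash A^s,\Delta_1$ and $\Gamma_2,A^s\vdash\Delta_2$ infer $\Gamma_1,\Gamma_2\vdash\Delta_1,\Delta_2$); weakening, contraction, exchange; classical propositional sequent rules for $\neg,\wedge,\vee,\to$ (two-premise rules with contexts joined) with all active p-formulas at the same position; temporal rules: from $\Gamma,A^{s\oplus t}\vdash\Delta$ infer $\Gamma,(\Box A)^s\vdash\Delta$ ($t$ any position); from $\Gamma\vdash A^{s\oplus x},\Delta$ infer $\Gamma\vdash(\Box A)^s,\Delta$; from $\Gamma,A^{s\oplus x}\vdash\Delta$ infer $\Gamma,(\Diamond A)^s\vdash\Delta$; from $\Gamma\vdash A^{s\oplus t},\Delta$ infer $\Gamma\vdash(\Diamond A)^s,\Delta$ ($t$ any position); from $\Gamma,A^{s\oplus 1}\vdash\Delta$ infer $\Gamma,(\bigcirc A)^s\vdash\Delta$; from $\Gamma\vdash A^{s\oplus1},\Delta$ infer $\Gamma\vdash(\bigcirc A)^s,\Delta$; IND: from $\Gamma,A^{s\oplus x}\vdash A^{s\oplus x\oplus 1},\Delta$ infer $\Gamma,A^s\vdash A^{s\oplus t},\Delta$ ($t$ any position). In the right $\Box$ rule, the left $\Diamond$ rule and IND, $x\notin s,\Gamma,\Delta$. *)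

(* Defs.v *)
From mathcomp Require Import all_boot finmap.

Set Implicit Arguments.
Unset Strict Implicit.
Unset Printing Implicit Defensive.

Local Open Scope fset_scope.

Inductive formula (P : Type) : Type :=
| Var (p : P)
| Neg (A : formula P)
| And (A B : formula P)
| Or (A B : formula P)
| Imp (A B : formula P)
| Box (A : formula P)
| Dia (A : formula P)
| Next (A : formula P).

(* Propositional schemes: a temporal instance of a tautology is [pinst f a]
   with [ptautology a]. *)
Inductive pform : Type :=
| PVar (n : nat)
| PNeg (a : pform)
| PAnd (a b : pform)
| POr (a b : pform)
| PImp (a b : pform).

Fixpoint peval (v : nat -> bool) (a : pform) : bool :=
  match a with
  | PVar n => v n
  | PNeg a => ~~ peval v a
  | PAnd a b => peval v a && peval v b
  | POr a b => peval v a || peval v b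
  | PImp a b => peval v a ==> peval v b
  end.

Definition ptautology (a : pform) : Prop := forall v, peval v a.

Fixpoint pinst (P : Type) (f : nat -> formula P) (a : pform) : formula P :=
  match a with
  | PVar n => f n
  | PNeg a => Neg (pinst f a)
  | PAnd a b => And (pinst f a) (pinst f b)
  | POr a b => Or (pinst f a) (pinst f b)
  | PImp a b => Imp (pinst f a) (pinst f b)
  end.

Inductive LTL (P : Type) : formula P -> Prop :=
| LTL_A0 (a : pform) (f : nat -> formula P) :
    ptautology a -> LTL (pinst f a)
| LTL_A1 A B : LTL (Imp (Next (Imp A B)) (Imp (Next A) (Next B)))
| LTL_A2 A : LTL (Imp (Neg (Next A)) (Next (Neg A)))
| LTL_A3 A B : LTL (Imp (Box (Imp A B)) (Imp (Box A) (Box B)))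
| LTL_A4 A : LTL (Imp (Box A) A)
| LTL_A5 A : LTL (Imp (Box A) (Box (Box A)))
| LTL_A6 A : LTL (Imp (Box A) (Next A))
| LTL_A7 A : LTL (Imp (Box A) (Next (Box A)))
| LTL_A8 A : LTL (Imp (And A (Box (Imp A (Next A)))) (Box A))
| LTL_MP A B : LTL (Imp A B) -> LTL A -> LTL B
| LTL_Next A : LTL A -> LTL (Next A)
| LTL_Box A : LTL A -> LTL (Box A).

Definition token : Type := nat.

Definition position : Type := (nat * {fset token})%type.

Definition pos0 : position := (0, fset0).

Definition oplus (s t : position) : position := ((s.1 + t.1)%N, s.2 `|` t.2).

Definition oplus_nat (s : position) (m : nat) : position := oplus s (m, fset0).

Definition oplus_tok (s : position) (x : token) : position :=
  oplus s (0, [fset x]).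

(* The p-formula [A^s] is the pair [(A, s)]. *)
Definition p_formula (P : Type) : Type := (formula P * position)%type.

Definition fresh_pos (x : token) (s : position) : bool := x \notin s.2.

Definition fresh (P : Type) (x : token) (G : seq (p_formula P)) : bool :=
  all (fun F => fresh_pos x F.2) G.

(* [G ⊢ D]: the 2-sequent with antecedent [G] and succedent [D] is provable
   in 2_LTL.  Active formulas stand at the right end of the antecedent and at
   the left end of the succedent.  The propositional rules are Gentzen's (LK),
   hence two one-formula rules each for left [And] and right [Or]; in [R_Ind]
   the position [t] may contain the token [x]. *)
Reserved Notation "G ⊢ D" (at level 70, no associativity).

Inductive two_LTL (P : Type) : seq (p_formula P) -> seq (p_formula P) -> Prop :=
| R_Ax A s : [:: (A, s)] ⊢ [:: (A, s)]
| R_Cut A s G1 G2 D1 D2 :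
    G1 ⊢ (A, s) :: D1 -> G2 ++ [:: (A, s)] ⊢ D2 -> G1 ++ G2 ⊢ D1 ++ D2
| R_WeakL A s G D : G ⊢ D -> G ++ [:: (A, s)] ⊢ D
| R_WeakR A s G D : G ⊢ D -> G ⊢ (A, s) :: D
| R_ContrL A s G D :
    G ++ [:: (A, s); (A, s)] ⊢ D -> G ++ [:: (A, s)] ⊢ D
| R_ContrR A s G D :
    G ⊢ (A, s) :: (A, s) :: D -> G ⊢ (A, s) :: D
| R_ExchL A s B t G1 G2 D :
    G1 ++ (A, s) :: (B, t) :: G2 ⊢ D -> G1 ++ (B, t) :: (A, s) :: G2 ⊢ D
| R_ExchR A s B t G D1 D2 :
    G ⊢ D1 ++ (A, s) :: (B, t) :: D2 -> G ⊢ D1 ++ (B, t) :: (A, s) :: D2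
| R_NegL A s G D : G ⊢ (A, s) :: D -> G ++ [:: (Neg A, s)] ⊢ D
| R_NegR A s G D : G ++ [:: (A, s)] ⊢ D -> G ⊢ (Neg A, s) :: D
| R_AndL1 A B s G D : G ++ [:: (A, s)] ⊢ D -> G ++ [:: (And A B, s)] ⊢ D
| R_AndL2 A B s G D : G ++ [:: (B, s)] ⊢ D -> G ++ [:: (And A B, s)] ⊢ D
| R_AndR A B s G1 G2 D1 D2 :
    G1 ⊢ (A, s) :: D1 -> G2 ⊢ (B, s) :: D2 ->
    G1 ++ G2 ⊢ (And A B, s) :: D1 ++ D2
| R_OrL A B s G1 G2 D1 D2 :
    G1 ++ [:: (A, s)] ⊢ D1 -> G2 ++ [:: (B, s)] ⊢ D2 ->
    G1 ++ G2 ++ [:: (Or A B, s)] ⊢ D1 ++ D2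
| R_OrR1 A B s G D : G ⊢ (A, s) :: D -> G ⊢ (Or A B, s) :: D
| R_OrR2 A B s G D : G ⊢ (B, s) :: D -> G ⊢ (Or A B, s) :: D
| R_ImpL A B s G1 G2 D1 D2 :
    G1 ⊢ (A, s) :: D1 -> G2 ++ [:: (B, s)] ⊢ D2 ->
    G1 ++ G2 ++ [:: (Imp A B, s)] ⊢ D1 ++ D2
| R_ImpR A B s G D :
    G ++ [:: (A, s)] ⊢ (B, s) :: D -> G ⊢ (Imp A B, s) :: D
| R_BoxL A s t G D :
    G ++ [:: (A, oplus s t)] ⊢ D -> G ++ [:: (Box A, s)] ⊢ D
| R_BoxR A s x G D :
    fresh_pos x s -> fresh x G -> fresh x D ->
    G ⊢ (A, oplus_tok s x) :: D -> G ⊢ (Box A, s) :: D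
| R_DiaL A s x G D :
    fresh_pos x s -> fresh x G -> fresh x D ->
    G ++ [:: (A, oplus_tok s x)] ⊢ D -> G ++ [:: (Dia A, s)] ⊢ D
| R_DiaR A s t G D :
    G ⊢ (A, oplus s t) :: D -> G ⊢ (Dia A, s) :: D
| R_NextL A s G D :
    G ++ [:: (A, oplus_nat s 1)] ⊢ D -> G ++ [:: (Next A, s)] ⊢ D
| R_NextR A s G D :
    G ⊢ (A, oplus_nat s 1) :: D -> G ⊢ (Next A, s) :: D
| R_Ind A s t x G D :
    fresh_pos x s -> fresh x G -> fresh x D ->
    G ++ [:: (A, oplus_tok s x)] ⊢ (A, oplus_nat (oplus_tok s x) 1) :: D ->
    G ++ [:: (A, s)] ⊢ (A, oplus s t) :: D
where "G ⊢ D" := (two_LTL G D).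

(* Main.v *)
Require Import Defs.
From mathcomp Require Import all_boot finmap.
From Stdlib Require List.

(** Every theorem of LTL is provable at every position [s], by induction on
    its derivation: generalizing over [s] is what makes the two necessitation
    rules go through, since their premise is then available at [s ⊕ 1] and at
    [s ⊕ x] for a fresh token [x].  The induction axiom A8 is an instance of
    IND.  Tautologies are handled by Kalmár's argument: a propositional scheme
    is decided by the literals of a valuation, and the literals are then
    removed by cuts. *)

Set Implicit Arguments.
Unset Strict Implicit.
Unset Printing Implicit Defensive.

Local Open Scope fset_scope.

Ltac incl_tac :=
  let F := fresh in
  move=> F; rewrite /= ?List.in_app_iff /= ?List.in_app_iff /=; tauto.

(** * Structural rules *)

Section Structural.
Context {P : Type}.
Implicit Types (F : p_formula P) (G D H K : seq (p_formula P)).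

(** The exchange rule only swaps neighbours: a single formula is carried past the block [K], and the
    formulas of [H] are then moved one by one, the last first. *)
Lemma exchange_blocksL H K G1 G2 D :
  G1 ++ H ++ K ++ G2 ⊢ D -> G1 ++ K ++ H ++ G2 ⊢ D.
Proof.
have move1 F K' G1' G2' :
    G1' ++ F :: K' ++ G2' ⊢ D -> G1' ++ K' ++ F :: G2' ⊢ D.
  elim: K' G1' => [|[B t] K' IHK] G1' //= GD.
  rewrite -cat_rcons; apply: IHK; rewrite cat_rcons.
  by case: F GD => A s; apply: R_ExchL.
elim: H G1 => [|F H IHH] G1 //= GD.
by apply: move1; rewrite -cat_rcons; apply: IHH; rewrite cat_rcons.
Qed.

Lemma exchange_blocksR H K G D1 D2 :
  G ⊢ D1 ++ H ++ K ++ D2 -> G ⊢ D1 ++ K ++ H ++ D2.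
Proof.
have move1 F K' D1' D2' :
    G ⊢ D1' ++ F :: K' ++ D2' -> G ⊢ D1' ++ K' ++ F :: D2'.
  elim: K' D1' => [|[B t] K' IHK] D1' //= GD.
  rewrite -cat_rcons; apply: IHK; rewrite cat_rcons.
  by case: F GD => A s; apply: R_ExchR.
elim: H D1 => [|F H IHH] D1 //= GD.
by apply: move1; rewrite -cat_rcons; apply: IHH; rewrite cat_rcons.
Qed.

Lemma weakenL H G D : G ⊢ D -> G ++ H ⊢ D.
Proof.
elim: H G => [|[A s] H IHH] G GD; first by rewrite cats0.
by rewrite -cat1s catA; apply: IHH; apply: R_WeakL.
Qed.

Lemma weakenR H G D : G ⊢ D -> G ⊢ H ++ D.
Proof. by move=> GD; elim: H => [|[A s] H IHH] //=; apply: R_WeakR. Qed.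

(** Each formula of [H] has a copy in [G]; exchange brings the two together and contraction merges
    them. *)
Lemma absorbL H G D : List.incl H G -> G ++ H ⊢ D -> G ⊢ D.
Proof.
elim: H G => [|[A s] H IHH] G HG GD; first by rewrite cats0 in GD.
have GHF : G ++ [:: (A, s)] ⊢ D.
  apply: IHH; last by rewrite -catA.
  by move=> F FH; apply/List.in_app_iff; left; apply: HG; right.
have [G1 [G2 defG]] := List.in_split _ _ (HG _ (or_introl erefl)).
move: GHF; rewrite {}defG {IHH HG GD} -catA -(cat1s _ G2) => GD.
have := @exchange_blocksL G2 [:: (A, s)] G1 [::] D; rewrite !cats0; apply.
rewrite catA; apply: R_ContrL; rewrite -catA.
exact: (@exchange_blocksL [:: (A, s)] G2 G1 [:: (A, s)] D).
Qed.

Lemma absorbR H G D : List.incl H D -> G ⊢ H ++ D -> G ⊢ D.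
Proof.
elim: H => [|[A s] H IHH] //= HD GD; apply: IHH.
  by move=> F FH; apply: HD; right.
have [D1 [D2 defD]] := List.in_split _ _ (HD _ (or_introl erefl)).
move: GD; rewrite {}defD {HD} (catA H D1) => GD.
have := @exchange_blocksR [:: (A, s)] (H ++ D1) G [::] D2; rewrite /= -catA.
apply; apply: R_ContrR; rewrite (catA H).
exact: (@exchange_blocksR (H ++ D1) [:: (A, s)] G [:: (A, s)] D2).
Qed.

(** Both sides of a sequent thus behave as sets, since [List.incl] ignores order and multiplicity.
    Weakening adds the target context, which then absorbs the original one. *)
Lemma two_LTL_incl G D G' D' :
  G ⊢ D -> List.incl G G' -> List.incl D D' -> G' ⊢ D'.
Proof.
move=> GD GG' DD'; apply: (absorbR DD').
have := @exchange_blocksR D' D G' [::] [::]; rewrite /= !cats0; apply.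
apply: weakenR; apply: (absorbL GG').
have := @exchange_blocksL G G' [::] [::] D; rewrite /= !cats0; apply.
exact: weakenL.
Qed.

Lemma axiom_mem F G D : List.In F G -> List.In F D -> G ⊢ D.
Proof.
case: F => A s FG FD.
by apply: (two_LTL_incl (R_Ax A s)) => F /= [<-|[]].
Qed.

End Structural.

(** * Context-sharing rules *)

Section ContextSharing.
Context {P : Type}.
Implicit Types (A B : formula P) (s t : position) (G D : seq (p_formula P)).

Lemma front_back (F : p_formula P) G D : F :: G ⊢ D -> G ++ [:: F] ⊢ D.
Proof. by move=> GD; apply: (two_LTL_incl GD); incl_tac. Qed.

Lemma back_front (F : p_formula P) G D : G ++ [:: F] ⊢ D -> F :: G ⊢ D.
Proof. by move=> GD; apply: (two_LTL_incl GD); incl_tac. Qed.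

(** The primitive rule joins contexts and so doubles [G] and [D]; [two_LTL_incl] merges the copies.
    The other two-premise rules below follow the same scheme. *)
Lemma cut (F : p_formula P) G D : G ⊢ F :: D -> F :: G ⊢ D -> G ⊢ D.
Proof.
case: F => A s GD /front_back FGD.
by apply: (two_LTL_incl (R_Cut GD FGD)); incl_tac.
Qed.

Lemma negL A s G D : G ⊢ (A, s) :: D -> (Neg A, s) :: G ⊢ D.
Proof. by move=> GD; apply: back_front; apply: R_NegL. Qed.

Lemma negR A s G D : (A, s) :: G ⊢ D -> G ⊢ (Neg A, s) :: D.
Proof. by move=> GD; apply: R_NegR; apply: front_back. Qed.

Lemma andL A B s G D :
  [:: (A, s), (B, s) & G] ⊢ D -> (And A B, s) :: G ⊢ D.
Proof.
move=> /front_back/(R_AndL1 B) GDA.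
have GDB : ((And A B, s) :: G) ++ [:: (B, s)] ⊢ D.
  by apply: (two_LTL_incl GDA); incl_tac.
by apply: (two_LTL_incl (R_AndL2 A GDB)); incl_tac.
Qed.

Lemma andR A B s G D :
  G ⊢ (A, s) :: D -> G ⊢ (B, s) :: D -> G ⊢ (And A B, s) :: D.
Proof.
by move=> GA GB; apply: (two_LTL_incl (R_AndR GA GB)); incl_tac.
Qed.

Lemma orL A B s G D :
  (A, s) :: G ⊢ D -> (B, s) :: G ⊢ D -> (Or A B, s) :: G ⊢ D.
Proof.
move=> /front_back GA /front_back GB.
by apply: (two_LTL_incl (R_OrL GA GB)); incl_tac.
Qed.

Lemma impL A B s G D :
  G ⊢ (A, s) :: D -> (B, s) :: G ⊢ D -> (Imp A B, s) :: G ⊢ D.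
Proof.
move=> GA /front_back GB.
by apply: (two_LTL_incl (R_ImpL GA GB)); incl_tac.
Qed.

Lemma impR A B s G D : (A, s) :: G ⊢ (B, s) :: D -> G ⊢ (Imp A B, s) :: D.
Proof. by move=> GD; apply: R_ImpR; apply: front_back. Qed.

Lemma nextL A s G D : (A, oplus_nat s 1) :: G ⊢ D -> (Next A, s) :: G ⊢ D.
Proof. by move=> /front_back GD; apply: back_front; apply: R_NextL. Qed.

Lemma boxL t A s G D : (A, oplus s t) :: G ⊢ D -> (Box A, s) :: G ⊢ D.
Proof. by move=> /front_back GD; apply: back_front; apply: R_BoxL GD. Qed.

Lemma two_LTL_swap (F1 F2 : p_formula P) G D :
  [:: F1, F2 & G] ⊢ D -> [:: F2, F1 & G] ⊢ D.
Proof. by move=> GD; apply: (two_LTL_incl GD); incl_tac. Qed.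

End ContextSharing.

(** * Tautologies *)

Fixpoint pvars (a : pform) : seq nat :=
  match a with
  | PVar n => [:: n]
  | PNeg a => pvars a
  | PAnd a b | POr a b | PImp a b => pvars a ++ pvars b
  end.

Section Tautologies.
Context {P : Type}.
Context (f : nat -> formula P) (s : position).
Implicit Types (G D : seq (p_formula P)) (v : nat -> bool) (ns : seq nat).

(** Kalmár's literals without negations: the side of the sequent carries the sign. Asking only for
    membership keeps the property stable when the contexts grow. *)
Definition decides v ns G D : Prop :=
  {in ns, forall n, List.In (f n, s) (if v n then G else D)}.

Lemma decides_cat v ns1 ns2 G D :
  decides v (ns1 ++ ns2) G D -> decides v ns1 G D /\ decides v ns2 G D.
Proof.
by move=> dec; split=> n n_in; apply: dec; rewrite mem_cat n_in ?orbT.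
Qed.

Lemma decides_pinst a v G D :
  decides v (pvars a) G D ->
  if peval v a then G ⊢ (pinst f a, s) :: D else (pinst f a, s) :: G ⊢ D.
Proof.
elim: a G D => [n|a IHa|a IHa b IHb|a IHa b IHb|a IHa b IHb] G D /=.
- move=> /(_ n (mem_head _ _)); case: (v n) => [nG|nD].
    by apply: axiom_mem nG _; left.
  by apply: axiom_mem nD; left.
- by move=> /IHa; case: (peval v a) => /=; [apply: negL|apply: negR].
- move=> /decides_cat[deca decb].
  have := IHa _ _ deca; case: (peval v a) => /= GA; last first.
    by apply: andL; apply: (two_LTL_incl GA); incl_tac.
  have := IHb _ _ decb; case: (peval v b) => /= GB; first exact: andR.
  by apply: andL; apply: (two_LTL_incl GB); incl_tac.
- move=> /decides_cat[deca decb].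
  have := IHa _ _ deca; case: (peval v a) => /= GA; first exact: R_OrR1.
  have := IHb _ _ decb; case: (peval v b) => /= GB; first exact: R_OrR2.
  exact: orL.
- move=> /decides_cat[deca decb].
  have := IHa _ _ deca; case: (peval v a) => /= GA; last first.
    by apply: impR; apply: (two_LTL_incl GA); incl_tac.
  have := IHb _ _ decb; case: (peval v b) => /= GB; last exact: impL.
  by apply: impR; apply: (two_LTL_incl GB); incl_tac.
Qed.

(** Cutting on [f n] for each [n] in [ns] splits into all valuations. The hypothesis ranges over
    larger contexts because every cut adds a formula to one side. *)
Lemma cut_literals ns G D :
  (forall v G' D', List.incl G G' -> List.incl D D' ->
     decides v ns G' D' -> G' ⊢ D') ->
  G ⊢ D.
Proof.
elim: ns G D => [|n ns IHns] G D GD.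
  by apply: (GD xpredT) => // F.
apply: (cut (F := (f n, s))); apply: IHns => v G' D' GG' DD' dec.
(* In this premise of the cut [f n] is in the succedent, so the valuation is reset to false at [n];
   this is sound even if [n] recurs in [ns]. The other premise resets it to true. *)
- apply: (GD (fun m => (m != n) && v m)) => //.
    by move=> F FD; apply: DD'; right.
  move=> m; rewrite inE; case: eqP => [->|_] /= => [_|/dec //].
  by apply: DD'; left.
- apply: (GD (fun m => (m == n) || v m)) => //.
    by move=> F FD; apply: GG'; right.
  move=> m; rewrite inE; case: eqP => [->|_] /= => [_|/dec //].
  by apply: GG'; left.
Qed.

Lemma tautology_two_LTL a : ptautology a -> [::] ⊢ [:: (pinst f a, s)].
Proof.
move=> taut; apply: (@cut_literals (pvars a)) => v G D _ aD dec.
have := decides_pinst dec; rewrite taut => GD.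
(* The instance already lies in [D], so the new copy is absorbed. *)
apply: (two_LTL_incl GD) => // F [<-|//]; by apply: aD; left.
Qed.

End Tautologies.

(** * Positions and temporal axioms *)

Lemma oplus_pos0 s : oplus s pos0 = s.
Proof. by case: s => n S; rewrite /oplus /= addn0 fsetU0. Qed.

Lemma oplusA s t u : oplus (oplus s t) u = oplus s (oplus t u).
Proof. by rewrite /oplus /= addnA fsetUA. Qed.

Lemma ex_fresh (s : position) : exists x, fresh_pos x s.
Proof.
exists (\max_(i <- s.2) i).+1; apply/negP => x_in.
by have := @leq_bigmax_seq _ _ xpredT id _ x_in isT; rewrite ltnn.
Qed.

Lemma LTL_two_LTL (P : Type) (A : formula P) :
  LTL A -> forall s, [::] ⊢ [:: (A, s)].
Proof.
elim=> {A} [a f taut|A B|A|A B|A|A|A|A|A|A B _ IHAB _ IHA|A _ IHA|A _ IHA] s.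
- exact: tautology_two_LTL.
- apply: impR; apply: nextL; apply: impR; apply: nextL; apply: R_NextR.
  apply: two_LTL_swap; by apply: impL; apply: axiom_mem; left.
- apply: impR; apply: R_NextR; apply: negR.
  apply: two_LTL_swap; apply: negL; apply: R_NextR.
  by apply: axiom_mem; left.
- have [x xs] := ex_fresh s.
  apply: impR; apply: impR; apply: (R_BoxR (x := x)) => //=.
    by rewrite /fresh /= xs.
  apply: boxL; apply: two_LTL_swap; apply: boxL; apply: impL.
    by apply: axiom_mem; left.
  by apply: axiom_mem; left.
- apply: impR; apply: (boxL (t := pos0)); rewrite oplus_pos0.
  by apply: axiom_mem; left.
(* The inner right [Box] rule acts at [s ⊕ x], so [y] must avoid [x] as well as [s]. *)
- have [x xs] := ex_fresh s; have [y ysx] := ex_fresh (oplus_tok s x).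
  have ys : fresh_pos y s by apply: contra ysx; rewrite inE => ->.
  apply: impR; apply: (R_BoxR (x := x)) => //=; first by rewrite /fresh /= xs.
  apply: (R_BoxR (x := y)) => //=; first by rewrite /fresh /= ys.
  (* By associativity, one left [Box] rule with [t = x ⊕ y] reaches the position [s ⊕ x ⊕ y]. *)
  apply: boxL; rewrite /oplus_tok oplusA.
  by apply: axiom_mem; left.
- apply: impR; apply: boxL; apply: R_NextR.
  by apply: axiom_mem; left.
- have [x xs] := ex_fresh s.
  apply: impR; apply: R_NextR; apply: (R_BoxR (x := x)) => //=.
  + by rewrite /fresh_pos /= fsetU0.
  + by rewrite /fresh /= xs.
  apply: boxL; rewrite /oplus_tok /oplus_nat oplusA.
  by apply: axiom_mem; left.
- have [x xs] := ex_fresh s.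
  apply: impR; apply: andL.
  apply: (R_BoxR (x := x)) => //=; first by rewrite /fresh /= xs.
  (* IND is used with [t] equal to [{x}] itself: the token just introduced by the right [Box] rule
     also serves as the eigentoken, as it is fresh for [s] and for the remaining context. *)
  apply: (back_front (G := [:: _])); apply: (R_Ind _ (x := x)) => //=.
    by rewrite /fresh /= xs.
  apply: boxL; apply: impL; first by apply: axiom_mem; left.
  by apply: nextL; apply: axiom_mem; left.
- apply: (cut (F := (A, s))).
    by apply: (two_LTL_incl (IHA s)) => F //= [<-|//]; left.
  apply: (cut (F := (Imp A B, s))).
    by apply: (two_LTL_incl (IHAB s)) => F //= [<-|//]; left.
  apply: impL; first by apply: axiom_mem; left.
  by apply: axiom_mem; left.
- exact: R_NextR.
- have [x xs] := ex_fresh s.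
  exact: (R_BoxR (x := x)).
Qed.

Theorem mainTheorem13 (P : Type) (A : formula P) :
  LTL A -> [::] ⊢ [:: (A, pos0)].
Proof.
by move=> LA; apply: LTL_two_LTL.
Qed.
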